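(* The class of transversal matroids is not pigeonhole.
   Context: All matroids are finite. For a matroid $M$ and $U\subseteq E(M)$, let $\lambda_M(U)=r_M(U)+r_M(E(M)-U)-r(M)$. For $X,X'\subseteq U$, write $X\sim_U X'$ if for every $Z\subseteq E(M)-U$, $X\cup Z$ is independent in $M$ iff $X'\cup Z$ is independent in $M$. A subcubic tree is a tree in which every vertex has degree three or one; degree-one vertices are leaves. A decomposition of $M$ is a pair $(T,\varphi)$ with $T$ a subcubic tree and $\varphi$ a bijection from $E(M)$ to the leaves of $T$. Deleting an edge $e$ of $T$ splits the leaves into two parts, giving a partition $(U_e,V_e)$ of $E(M)$; the sets $U_e$ and $V_e$ are displayed by $e$. The branch-width $\mathrm{bw}(M)$ is the minimum over decompositions $(T,\varphi)$ of the maximum of $\lambda_M(U_e)+1$ over edges $e$ of $T$. The decomposition-width $\mathrm{dw}(M)$ is the minimum over decompositions $(T,\varphi)$ of the maximum number of equivalence classes of $\sim_U$ over all sets $U$ displayed by an edge of $T$. A class $\mathcal{M}$ of matroids is pigeonhole if for every positive integer $\lambda$ there is an integer $\rho(\lambda)$ such that $\mathrm{bw}(M)\le\lambda$ implies $\mathrm{dw}(M)\le\rho(\lambda)$ for every $M\in\mathcal{M}$. *)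

(* Defs.v *)
From mathcomp Require Import all_boot.
From mathcomp Require Import boolp.

Set Implicit Arguments.
Unset Strict Implicit.
Unset Printing Implicit Defensive.

(** * Matroids *)

(* A finite matroid; the ground set E(M) is the whole type E. *)
Record matroid (E : finType) := Matroid {
  indep : pred {set E};
  indep0 : indep set0;
  indepS : forall I J : {set E}, I \subset J -> indep J -> indep I;
  indep_augment : forall I J : {set E}, indep I -> indep J -> #|I| < #|J| ->
    exists2 x, x \in J :\: I & indep (x |: I)
}.

Definition rank (E : finType) (M : matroid E) (X : {set E}) : nat :=
  \max_(I : {set E} | indep M I && (I \subset X)) #|I|.

(* The subtraction on nat does not truncate: r(E) <= r(U) + r(E - U). *)
Definition lambda (E : finType) (M : matroid E) (U : {set E}) : nat :=
  rank M U + rank M (~: U) - rank M setT.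

Definition sim (E : finType) (M : matroid E) (U : {set E}) : rel {set E} :=
  fun X X' => [forall Z : {set E},
    (Z \subset ~: U) ==> (indep M (X :|: Z) == indep M (X' :|: Z))].

Definition sim_classes (E : finType) (M : matroid E) (U : {set E}) : nat :=
  #|equivalence_partition (sim M U) (powerset U)|.

(** * Subcubic trees and decompositions *)

Definition degree (T : finType) (adj : rel T) (v : T) : nat :=
  #|[set w | adj v w]|.

(* An edge {v, w} satisfies both adj v w and adj w v, so the duplicate-free
   adj-cycles with at most two vertices are not graph cycles. *)
Record subcubic_tree := SubcubicTree {
  vertex :> finType;
  adj : rel vertex;
  adj_sym : symmetric adj;
  adj_irr : irreflexive adj;
  tree_nonempty : 0 < #|vertex|;
  tree_connected : forall v w : vertex, connect adj v w;
  tree_acyclic : forall c : seq vertex, ucycle adj c -> size c <= 2;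
  tree_subcubic : forall v : vertex, degree adj v = 1 \/ degree adj v = 3
}.

Definition leaves (T : subcubic_tree) : {set T} :=
  [set v | degree (@adj T) v == 1].

Record decomposition (E : finType) := Decomposition {
  dtree : subcubic_tree;
  dmap : E -> dtree;
  dmap_inj : injective dmap;
  dmap_leaves : [set dmap x | x : E] = leaves dtree
}.

Definition del_edge (T : subcubic_tree) (v w : T) : rel T :=
  fun a b => adj a b && ([set a; b] != [set v; w]).

(* The side of the edge {v, w} containing v. The two orientations of an edge e
   give the two displayed sets U_e and V_e. *)
Definition displayed (E : finType) (D : decomposition E) (v w : dtree D) :
    {set E} :=
  [set x | connect (del_edge v w) v (dmap D x)].

(* Both maxima run over oriented edges, i.e. over all displayed sets. *)
Definition decomp_bw (E : finType) (M : matroid E) (D : decomposition E) : nat :=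
  \max_(e : dtree D * dtree D | adj e.1 e.2) (lambda M (displayed e.1 e.2)).+1.

Definition decomp_dw (E : finType) (M : matroid E) (D : decomposition E) : nat :=
  \max_(e : dtree D * dtree D | adj e.1 e.2) sim_classes M (displayed e.1 e.2).

(** * Widths *)

(* The least element of P, and 0 when P is empty. *)
Definition min_nat (P : nat -> Prop) : nat :=
  if pselect (exists n, `[< P n >]) is left exP then ex_minn exP else 0.

(* A matroid with at most one element has no decomposition, since a subcubic
   tree has at least two leaves; both its widths are then 0. *)
Definition branch_width (E : finType) (M : matroid E) : nat :=
  min_nat (fun k => exists D : decomposition E, decomp_bw M D = k).

Definition decomposition_width (E : finType) (M : matroid E) : nat :=
  min_nat (fun k => exists D : decomposition E, decomp_dw M D = k).

(** * Classes of matroids *)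

Definition matroid_class := forall E : finType, matroid E -> Prop.

Definition pigeonhole (C : matroid_class) : Prop :=
  forall l : nat, 0 < l -> exists rho : nat,
    forall (E : finType) (M : matroid E), C E M ->
      branch_width M <= l -> decomposition_width M <= rho.

(* X is a partial transversal of the family (A_j): there is an injection f from
   X to the index set with x \in A_(f x) for every x in X. *)
Definition partial_transversal (E : finType) (m : nat) (A : 'I_m -> {set E})
    (X : {set E}) : Prop :=
  exists f : {x : E | x \in X} -> 'I_m,
    injective f /\ forall x, val x \in A (f x).

Definition transversal_matroid : matroid_class := fun E M =>
  exists (m : nat) (A : 'I_m -> {set E}),
    forall X : {set E}, indep M X <-> partial_transversal A X.

(* Main.v *)
From mathcomp Require Import all_boot zify.
From mathcomp Require Import boolp.
Require Import Defs.

Set Implicit Arguments.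
Unset Strict Implicit.
Unset Printing Implicit Defensive.

(** Transversal matroids of bounded branch-width and unbounded
decomposition-width are found among the duals of rank-5 sparse paving
matroids. Fix k, and take points a_i and b_j (i, j < k) together with three
private points for every pair (i, j). The line of (i, j) consists of a_i, b_j
and the three private points of (i, j): it has five points, and two distinct
lines share at most one. The five-point sets that are not lines are then the
bases of a rank-5 matroid, and its dual M is the matroid used here: X is
independent in M when the complement of X has at least five points and is not a
line.

- The corank of M is 5, so lambda_M never exceeds 5 and the branch-width of M is
  at most 6, whatever k is ([lambda_cosparse]).

- M is transversal. A presentation consists of all the lines together with
  enough copies of the whole ground set to have |E| - 5 sets. A set whose
  complement is a line L cannot be matched, since nothing in it can represent
  L. Conversely let T be a five-point set that is not a line. Every line has a
  point outside T, and a private one unless T contains its three private points;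
  five points have room for the private points of one line only, so the
  representatives are distinct, and the remaining points go to the copies of
  the ground set ([line_transversal], [cosparse_transversal]).

- If s pairwise disjoint lines all meet both U and its complement, then the
  sets U \ L, for L one of these lines, are pairwise inequivalent under sim_U,
  because gluing the part of L' inside U to the part of L outside U never yields
  a line ([crossing_lines_not_sim], [sim_classes_cosparse]).

- Every decomposition displays a set U such that U and its complement both
  contain at least a third of the points a_i ([balanced_edge]). One of U and its
  complement contains half of the points b_j. Pairing points b_j in that side
  with points a_i in the other gives about k / 3 pairwise disjoint lines crossing
  U ([grid_sim_classes]). So the decomposition-width of M grows with k.

As the decomposition-width of a matroid without any decomposition is 0, the
existence of subcubic trees with a given number of leaves is needed as well
([tree_with_leaves]). *)

(** * Duals of sparse paving matroids *)

Section SparsePaving.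

Variables (E J : finType) (r : nat) (L : J -> {set E}).
Hypotheses (r_gt2 : 2 < r) (cardL : forall j, #|L j| = r).
Hypothesis L_linear : forall i j, i != j -> #|L i :&: L j| <= 1.

(** Coindependence in the rank-r matroid whose circuit-hyperplanes are the
lines, that is, independence in its dual. *)
Definition coindep (X : {set E}) : bool :=
  (r <= #|~: X|) && [forall j, ~: X != L j].

Lemma eq_line i j : 1 < #|L i :&: L j| -> i = j.
Proof. by move=> lt1; apply/eqP/negPn/negP => /L_linear; rewrite leqNgt lt1. Qed.

(** Two sets C \ x and C \ y share r - 1 > 1 points, so they cannot be distinct
lines. *)
Lemma linesD1 (C : {set E}) x y i j : #|C| = r.+1 -> x \in C -> y \in C ->
  C :\ x = L i -> C :\ y = L j -> x = y.
Proof.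
move=> cC xC yC exi eyj; apply/eqP/negPn/negP => neq_xy.
have eij : i = j.
  apply: eq_line; rewrite -exi -eyj.
  have -> : (C :\ x) :&: (C :\ y) = C :\: [set x; y].
    by apply/setP=> z; rewrite !inE negb_or; case: (z == x); case: (z == y); case: (z \in C).
  have := cardsID [set x; y] C.
  rewrite (setIidPr _) ?cards2 ?neq_xy ?cC; first by lia.
  by apply/subsetP=> z; rewrite !inE => /orP[] /eqP->.
have : y \in C :\ x by rewrite !inE eq_sym neq_xy.
by rewrite exi eij -eyj !inE eqxx.
Qed.

Lemma coindep0 : r < #|E| -> coindep set0.
Proof.
move=> ltrE; rewrite /coindep setC0 cardsT (ltnW ltrE) /=.
apply/forallP=> j; apply/eqP=> /(congr1 (fun A : {set E} => #|A|)).
by rewrite cardsT cardL => e; rewrite e ltnn in ltrE.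
Qed.

Lemma coindepS (I K : {set E}) : I \subset K -> coindep K -> coindep I.
Proof.
move=> sIK /andP[leK /forallP nK].
have sC : ~: K \subset ~: I by rewrite setCS.
rewrite /coindep (leq_trans leK (subset_leq_card sC)) /=.
apply/forallP=> j; apply/eqP=> eI; have /eqP[] := nK j.
by rewrite -eI; apply/eqP; rewrite eqEcard sC eI cardL.
Qed.

(** When the complement C of I has more than r + 1 points, any x outside I will
do. When it has r + 1, the points x that fail are those for which C \ x is a line;
by [linesD1] there is at most one, so K \ I = {x}, and counting shows that
K = x |: I, whose complement would be a line. *)
Lemma coindep_augment (I K : {set E}) : coindep I -> coindep K ->
  #|I| < #|K| -> exists2 x, x \in K :\: I & coindep (x |: I).
Proof.
move=> /andP[leI nI] /andP[leK nK] ltIK.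
have cI := cardsC I; have cK := cardsC K.
have CU x : ~: (x |: I) = (~: I) :\ x by rewrite setCU setIC setDE.
have cC x : x \in K :\: I -> #|(~: I) :\ x| = #|~: I|.-1.
  by rewrite inE -in_setC => /andP[xI _]; rewrite [in RHS](cardsD1 x) xI.
have [x xKI] : exists x, x \in K :\: I.
  by apply/set0Pn; rewrite -card_gt0 cardsD; have := subset_leq_card (subsetIr K I); lia.
have [ltI | geI] := ltnP r.+1 #|~: I|.
  exists x => //; rewrite /coindep CU; rewrite cC //.
  apply/andP; split; first by lia.
  apply/forallP=> j; apply/eqP=> e.
  by have := cardL j; rewrite -e cC //; lia.
have cIr : #|~: I| = r.+1 by lia.
have cKr : #|~: K| = r by lia.
have line_of y : y \in K :\: I -> ~~ coindep (y |: I) ->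
    exists i, (~: I) :\ y = L i.
  move=> yKI; rewrite negb_and CU cC // cIr leqnn /= => /forallPn[i].
  by rewrite negbK => /eqP; exists i.
have [//|ncosp] := pickP [pred y in K :\: I | coindep (y |: I)].
  by move=> y /andP[]; exists y.
have all_lines y : y \in K :\: I -> exists i, (~: I) :\ y = L i.
  by move=> yKI; apply: line_of => //; have := ncosp y; rewrite /= yKI /= => ->.
have [i exi] := all_lines x xKI.
have KI1 : K :\: I = [set x].
  apply/eqP; rewrite eq_sym eqEsubset sub1set xKI; apply/subsetP=> y yKI.
  have [j eyj] := all_lines y yKI; rewrite inE; apply/eqP.
  by apply: (linesD1 cIr _ _ eyj exi); [move: yKI | move: xKI]; rewrite !inE => /andP[].
have /forallP/(_ i)/eqP[] := nK; rewrite -exi -CU; congr (~: _); apply/esym/eqP.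
have sKU : K \subset x |: I.
  apply/subsetP=> y yK; rewrite !inE; have [//|/= yI] := boolP (y \in I).
    by rewrite orbT.
  by rewrite orbF -in_set1 -KI1 !inE yI.
have := cardsC (x |: I); rewrite CU cC // cIr => e.
by rewrite eq_sym eqEcard sKU; lia.
Qed.

(** If an r-subset S of T is a line, exchanging one point of S for a point of
T \ S gives a set that shares r - 1 points with S, hence not a line. *)
Lemma nonline_subset (T : {set E}) : r <= #|T| -> (forall j, T != L j) ->
  exists2 S : {set E}, S \subset T & #|S| = r /\ forall j, S != L j.
Proof.
rewrite leq_eqVlt => /orP[/eqP eT | ltT] nT; first by exists T.
have [S sST cS] : exists2 S : {set E}, S \subset T & #|S| = r.
  exists [set x in take r (enum T)].
    by apply/subsetP=> x; rewrite inE => /mem_take; rewrite mem_enum.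
  rewrite cardsE (card_uniqP _) ?take_uniq ?enum_uniq // size_take -cardE ltT //.
have [/forallP nS | /forallPn[i]] := boolP [forall j, S != L j].
  by exists S.
rewrite negbK => /eqP eS.
have [x xT xS] : exists2 x, x \in T & x \notin S.
  by apply/subsetPn; apply: contraL ltT => /subset_leq_card; rewrite cS -leqNgt.
have [y yS] : exists y, y \in S by apply/set0Pn; rewrite -card_gt0 cS; lia.
have cSy : #|S :\ y| = r.-1 by have := cardsD1 y S; rewrite yS cS; lia.
exists (x |: (S :\ y)).
  by apply/subsetP=> z; rewrite !inE => /orP[/eqP->// | /andP[_ /(subsetP sST)]].
split; first by rewrite cardsU1 cSy !inE (negPf xS) andbF /=; lia.
move=> j; apply/eqP=> eSj.
have eij : i = j.
  apply: eq_line; rewrite -eS -eSj; apply: (@leq_trans #|S :\ y|); first by rewrite cSy; lia.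
  by apply: subset_leq_card; apply/subsetP=> z; rewrite !inE => /andP[-> ->]; rewrite orbT.
have : x \in S by rewrite eS eij -eSj !inE eqxx.
by rewrite (negPf xS).
Qed.

Definition cosparse_matroid (ltrE : r < #|E|) : matroid E :=
  Matroid (coindep0 ltrE) coindepS coindep_augment.

Section Widths.
Variable ltrE : r < #|E|.
Let M := cosparse_matroid ltrE.

Lemma rank_le_card (X : {set E}) : rank M X <= #|X|.
Proof. by apply/bigmax_leqP => I /andP[_ /subset_leq_card]. Qed.

Lemma rank_cosparse : #|E| - r <= rank M setT.
Proof.
have [||S _ [cS nS]] := @nonline_subset setT; first by rewrite cardsT ltnW.
  move=> j; apply/eqP=> /(congr1 (fun A : {set E} => #|A|)).
  by rewrite cardsT cardL => e; have := ltrE; rewrite e ltnn.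
have -> : #|E| - r = #|~: S| by rewrite -(cardsC S) cS addKn.
apply: (@leq_bigmax_cond _ (fun I => indep M I && (I \subset setT)) (fun I : {set E} => #|I|)).
rewrite subsetT andbT /= /coindep setCK cS leqnn /=.
by apply/forallP.
Qed.

Lemma lambda_cosparse (U : {set E}) : lambda M U <= r.
Proof.
rewrite /lambda; have := rank_cosparse; have := rank_le_card U.
by have := rank_le_card (~: U); have := cardsC U; lia.
Qed.

(** The glued set has r > 2 points, so it meets L i or L j in at least two; were
it a line, it would be that one, but it contains a point of the other. *)
Lemma disjoint_lines_split (U : {set E}) i j : [disjoint L i & L j] ->
  L j :&: U != set0 -> L i :\: U != set0 ->
  forall l, (L j :&: U) :|: (L i :\: U) != L l.
Proof.
move=> dis /set0Pn[y /setIP[yj yU]] /set0Pn[x /setDP[xi xU]] l; apply/eqP=> e.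
have sj : L j :&: U \subset L j :&: L l.
  by rewrite -e; apply/subsetP=> z; rewrite !inE => /andP[-> ->].
have si : L i :\: U \subset L i :&: L l.
  by rewrite -e; apply/subsetP=> z; rewrite !inE => /andP[-> ->]; rewrite orbT.
have ci := subset_leq_card si; have cj := subset_leq_card sj.
have := (leq_card_setU (L j :&: U) (L i :\: U)).1; rewrite e cardL => cU.
have [gti | lei] := ltnP 1 #|L i :&: L l|.
  have eil := eq_line gti.
  have : y \in L i by rewrite eil -e !inE yj yU.
  by rewrite (disjointFl dis).
have gtj : 1 < #|L j :&: L l| by lia.
have ejl := eq_line gtj.
have : x \in L j by rewrite ejl -e !inE xi xU orbT.
by rewrite (disjointFr dis).
Qed.

Lemma sim_sym (U X Y : {set E}) : sim M U X Y = sim M U Y X.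
Proof. by apply: eq_forallb => Z; rewrite eq_sym. Qed.

(** Both sets are extended by the points outside U and L i. The complements of
the two unions are L i itself, and the part of L j inside U glued to the part of
L i outside U. The cardinality hypothesis makes the latter have at least r points,
so that exactly one of the two unions is independent. *)
Lemma crossing_lines_not_sim (U : {set E}) i j : [disjoint L i & L j] ->
  L j :&: U != set0 -> L i :\: U != set0 -> #|L i :&: U| <= #|L j :&: U| ->
  ~~ sim M U (U :\: L i) (U :\: L j).
Proof.
move=> dis nj ni le; apply/forallPn; exists (~: U :\: L i).
have C k : ~: ((U :\: L k) :|: (~: U :\: L i)) = (L k :&: U) :|: (L i :\: U).
  by apply/setP=> z; rewrite !inE; case: (z \in U); rewrite /= ?andbT ?andbF ?orbF ?negbK.
rewrite negb_imply subsetDl /= /coindep !C.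
have -> : (L i :&: U) :|: (L i :\: U) = L i.
  by apply/setP=> z; rewrite !inE; case: (z \in U); rewrite /= ?andbT ?andbF ?orbF.
have -> : [forall k, L i != L k] = false by apply/negbTE/forallPn; exists i; rewrite eqxx.
have -> : [forall k, (L j :&: U) :|: (L i :\: U) != L k].
  by apply/forallP; apply: disjoint_lines_split.
rewrite andbF andbT eq_sym eqbF_neg negbK cardsU.
have -> : (L j :&: U) :&: (L i :\: U) = set0.
  by apply/setP=> z; rewrite !inE; case: (z \in U); rewrite ?andbF.
by rewrite cards0 subn0 -(cardL i) -(cardsID U (L i)) leq_add2r.
Qed.

Lemma sim_classes_cosparse (U : {set E}) (s : nat) (f : 'I_s -> J) :
  (forall t t', t != t' -> [disjoint L (f t) & L (f t')]) ->
  (forall t, L (f t) :&: U != set0) -> (forall t, L (f t) :\: U != set0) ->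
  s <= sim_classes M U.
Proof.
move=> dis inU outU.
pose cls t := [set Y in powerset U | sim M U (U :\: L (f t)) Y].
have inj_cls : injective cls.
  move=> t t' ecls; apply/eqP; apply: contraT => ntt'.
  have : U :\: L (f t') \in cls t.
    rewrite ecls !inE subsetDl; apply/forallP=> Z; by rewrite eqxx implybT.
  rewrite inE => /andP[_ simtt'].
  have [le | /ltnW le] := leqP #|L (f t) :&: U| #|L (f t') :&: U|.
    by have := crossing_lines_not_sim (dis _ _ ntt') (inU _) (outU _) le; rewrite simtt'.
  rewrite eq_sym in ntt'.
  by have := crossing_lines_not_sim (dis _ _ ntt') (inU _) (outU _) le; rewrite sim_sym simtt'.
rewrite /sim_classes -[leqLHS]card_ord -cardsT -(card_imset _ inj_cls).
apply: subset_leq_card; apply/subsetP=> _ /imsetP[t _ ->].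
by apply/imsetP; exists (U :\: L (f t)); rewrite // powersetE subsetDl.
Qed.

End Widths.

Section Transversal.
Variable ltrE : r < #|E|.
Variable P : J -> {set E}.
Hypothesis subPL : forall j, P j \subset L j.
Hypothesis P_private : forall i j, i != j -> [disjoint P i & L j].
Hypothesis P_large : forall j, r < #|P j|.*2.
Hypothesis few_lines : #|J| + r <= #|E|.

(** A private point outside T is preferred as the representative of a line. Two
lines with the same representative would both have all their private points in T,
which has too few elements for that. *)
Lemma line_transversal (T : {set E}) : #|T| = r -> (forall j, T != L j) ->
  exists2 g : J -> E, injective g & forall j, g j \in L j :\: T.
Proof.
move=> cT nT.
have ex j : exists x, (x \in L j :\: T) && ((P j \subset T) || (x \in P j)).
  have [sPT | /subsetPn[x xP xT]] := boolP (P j \subset T).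
    suff /subsetPn[x xL xT] : ~~ (L j \subset T) by exists x; rewrite !inE xL xT.
    by apply: contra (nT j) => sLT; rewrite eq_sym eqEcard sLT cT cardL leqnn.
  by exists x; rewrite !inE xT (subsetP (subPL j)) // xP orbT.
exists (fun j => xchoose (ex j)) => [i j eij | j]; last by have /andP[] := xchooseP (ex j).
have /andP[/setDP[iL _] iP] := xchooseP (ex i).
have /andP[/setDP[jL _] jP] := xchooseP (ex j).
apply/eqP; apply: contraT => nij.
have nji : j != i by rewrite eq_sym.
move: iP jP; rewrite -eij in jL *; rewrite [in X in _ -> X -> _]orbC.
rewrite (disjointFl (P_private nij) jL) orbF => PiT.
rewrite (disjointFl (P_private nji) iL) /= => PjT.
have := subset_leq_card (introT subUsetP (conj PiT PjT)).
rewrite cardsU cT disjoint_setI0 ?cards0.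
  by have := P_large i; have := P_large j; lia.
by apply: disjointWr (P_private nij); apply: subPL.
Qed.

(** The presentation consists of the lines and of |E| - r - |J| copies of the
ground set. *)
Lemma cosparse_transversal : transversal_matroid (cosparse_matroid ltrE).
Proof.
pose d := #|E| - r - #|J|.
pose A (t : 'I_(#|J| + d)) : {set E} :=
  if split t is inl j then L (enum_val j) else setT.
exists (#|J| + d), A => X; split; last first.
  case=> f [f_inj fA].
  have cX : #|X| = #|{: {x : E | x \in X}}| by rewrite card_sig.
  have lecX : #|X| <= #|J| + d by rewrite cX -[leqRHS]card_ord; apply: leq_card f_inj.
  have CX := cardsC X.
  rewrite /= /coindep; apply/andP; split; first by rewrite /d in lecX; lia.
  apply/forallP=> j; apply/eqP=> eX.
  have := cardL j; rewrite -eX => cCX.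
  (* |X| is the number of sets in the presentation, so the line L j is
     represented by a point of X, that is, outside L j. *)
  have [h _ hK] : bijective f.
    by apply: inj_card_bij => //; rewrite card_ord -cX /d; lia.
  have := fA (h (lshift d (enum_rank j))).
  rewrite hK /A (unsplitK (inl _ : 'I_#|J| + 'I_d)) enum_rankK -eX inE.
  by rewrite (valP (h _)).
move=> /andP[/= leX /forallP nX].
(* It is enough to match the complement of T, which contains X. *)
have [T sTX [cT nT]] := nonline_subset leX nX.
have [g g_inj gT] := line_transversal cT nT.
(* R holds the points that represent no line; the i-th of them is matched to
   the i-th copy of the ground set. *)
pose R := ~: T :\: [set g j | j : J].
have cg : #|[set g j | j : J]| = #|J| by rewrite card_imset.
have cR : #|R| = d.
  rewrite /R cardsD (setIidPr _) ?cg; last first.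
    by apply/subsetP=> _ /imsetP[j _ ->]; have := gT j; rewrite !inE => /andP[].
  by have := cardsC T; rewrite /d; lia.
have inR x (xX : x \in X) : x \notin [set g j | j : J] -> x \in R.
  by move=> xg; rewrite inE xg inE; apply: contraL xX => /(subsetP sTX); rewrite inE.
pose h x (xR : x \in R) : 'I_d := cast_ord cR (enum_rank_in xR x).
pose F (x : E) : 'I_#|J| + 'I_d -> Prop := fun t =>
  match t with inl j => x = g (enum_val j) | inr i => exists xR : x \in R, i = h x xR end.
have exF (x : {x : E | x \in X}) : exists t, F (val x) t.
  case: x => x xX /=; have [/imsetP[j _ ->] | xg] := boolP (x \in [set g j | j : J]).
    by exists (inl (enum_rank j)); rewrite /= enum_rankK.
  by exists (inr (h x (inR x xX xg))); exists (inR x xX xg).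
have [f fF] := choice exF.
exists (fun x => unsplit (f x)); split=> [x y /(can_inj (@unsplitK _ _)) exy | x]; last first.
  rewrite /A unsplitK; have := fF x; case: (f x) => [j | i] /=; last by move=> _; rewrite inE.
  by move=> ->; have := gT (enum_val j); rewrite inE => /andP[].
apply: val_inj; have := fF x; have := fF y; rewrite exy.
case: (f y) => [j /= -> -> // | i /= [yR ->] [xR]].
move/cast_ord_inj => /(congr1 enum_val).
by rewrite !enum_rankK_in.
Qed.

End Transversal.
End SparsePaving.

(** * Balanced edges of subcubic trees *)

Section BalancedEdge.

Variable T : subcubic_tree.
Implicit Types (u v w x : T) (Q : {set T}).

Definition branch v w : {set T} := [set x | connect (del_edge v w) v x].

(** A simple path from u to v avoiding the edge uv would close up to a cycle. *)
Lemma branch_notin u v : adj u v -> v \notin branch u v.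
Proof.
move=> uv; rewrite inE; apply/negP => /connectP[p pp ev].
case/shortenP: pp ev => {}p pp up _ ev.
have cyc : ucycle (@adj T) (u :: p).
  rewrite /ucycle up andbT /= rcons_path -ev adj_sym uv andbT.
  by apply: sub_path pp => a b /andP[].
have := tree_acyclic cyc.
case: p {up cyc} pp ev => [|z [|//]] /=.
  by move=> _ e; rewrite e (adj_irr u) in uv.
by move=> + e _; rewrite -e /del_edge eqxx !andbF.
Qed.

Lemma path_avoiding u v y p : path (@adj T) y p -> v \notin y :: p ->
  path (del_edge u v) y p.
Proof.
elim: p y => //= z p IH y /andP[yz pp].
rewrite inE negb_or => /andP[vy vzp]; rewrite IH // andbT /del_edge yz /=.
apply/eqP=> /setP/(_ v); rewrite !inE eqxx orbT (negPf vy) /= => vz.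
by rewrite inE vz in vzp.
Qed.

(** The first step of a simple path from v to x leads to a neighbour u of v, and
the path never comes back to v. The relation e serves for the whole tree as well
as for the tree without an edge at v. *)
Lemma branch_step (e : rel T) v x : subrel e (@adj T) -> connect e v x -> x != v ->
  exists2 u, e v u & x \in branch u v.
Proof.
move=> sub /connectP[p pp ex] nxv; case/shortenP: pp ex => {}p pp up _ ex.
case: p pp up ex => [|u p] /=; first by move=> _ _ exv; rewrite exv eqxx in nxv.
case/andP=> vu pp /andP[vp _] ex; exists u => //.
rewrite inE; apply/connectP; exists p => //.
by apply: path_avoiding vp; apply: sub_path pp.
Qed.

Lemma branch_sub u v w : adj v u -> u != w -> branch u v \subset branch v w.
Proof.
move=> vu nuw; have uv : adj u v by rewrite adj_sym.
have nv := branch_notin uv.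
have v_u : connect (del_edge v w) v u.
  apply: connect1; rewrite /del_edge vu /=; apply/eqP=> /setP/(_ u).
  rewrite !inE eqxx orbT (negPf nuw) orbF => /esym/eqP euv.
  by rewrite euv adj_irr in vu.
suff reach p y : path (del_edge u v) y p -> connect (del_edge u v) u y ->
    connect (del_edge v w) v y -> connect (del_edge v w) v (last y p).
  by apply/subsetP=> x; rewrite !inE => /connectP[p pp ->]; apply: reach.
elim: p y => //= z p IH y /andP[yz pp] uy vy.
have uz := connect_trans uy (connect1 yz).
apply: IH => //; apply: connect_trans vy _; apply: connect1.
rewrite /del_edge; have /andP[-> _] := yz => /=.
apply/eqP=> /setP/(_ v); rewrite !inE eqxx /= => /orP[]/eqP ev;
  by case/negP: nv; rewrite inE [X in connect _ _ X]ev.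
Qed.

Lemma card_other_neighbours v w : adj v w ->
  #|[set u | adj v u] :\ w| = (degree (@adj T) v).-1.
Proof. by move=> vw; rewrite /degree [in RHS](cardsD1 w) inE vw. Qed.

(** Among the oriented edges whose branch contains at least s points of Q, take
one, (v, w), with the smallest branch. Its end v is not a leaf, since the branch
would then contain at most one point of Q. The branches at the two other neighbours
of v cover its leaves, and each has fewer than s points of Q by minimality. *)
Lemma balanced_edge Q s : Q \subset leaves T -> 1 < s -> s < #|Q| ->
  exists v w, [/\ adj v w, s <= #|Q :&: branch v w|
                & #|Q :&: branch v w| <= (s.-1).*2].
Proof.
move=> Ql s_gt1 ltsQ.
pose big (e : T * T) := adj e.1 e.2 && (s <= #|Q :&: branch e.1 e.2|).
have [e0 big0] : exists e, big e.
  (* The edge at a leaf q of Q leaves all of Q but q on the other side. *)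
  have [q qQ] : exists q, q \in Q by apply/set0Pn; rewrite -card_gt0; lia.
  have := subsetP Ql q qQ; rewrite inE => /cards1P[w Nq].
  have qw : adj q w by have := set11 w; rewrite -Nq inE.
  exists (w, q); rewrite /big /= adj_sym qw /=.
  have := cardsD1 q Q; rewrite qQ => cQ.
  suff /subset_leq_card : Q :\ q \subset Q :&: branch w q by lia.
  apply/subsetP=> x; rewrite in_setD1 in_setI => /andP[nxq ->] /=.
  have [//| u qu xu] := branch_step _ (tree_connected q x) nxq.
  have : u \in [set w] by rewrite -Nq inE.
  by rewrite in_set1 => /eqP <-.
case: (arg_minnP (fun e : T * T => #|branch e.1 e.2|) big0) => -[v w] /andP[/= vw les] minvw.
exists v, w; split=> //.
have small u : u \in [set u | adj v u] :\ w -> #|Q :&: branch u v| <= s.-1.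
  rewrite !inE => /andP[nuw vu]; rewrite -ltnS prednK; last by lia.
  rewrite ltnNge; apply/negP=> leu.
  have uv : adj u v by rewrite adj_sym.
  have := minvw (u, v); rewrite /big /= uv leu => /(_ isT).
  rewrite leqNgt; case/negP; apply: proper_card; apply/properP; split.
    exact: branch_sub.
  by exists v; [rewrite inE connect0 | apply: branch_notin].
have cover x : x \in branch v w -> x != v ->
    exists2 u, u \in [set u | adj v u] :\ w & x \in branch u v.
  rewrite [x \in _]inE => vx nxv.
  have [|u /andP[vu nu] xu] := branch_step _ vx nxv; first by move=> a b /andP[].
  by exists u; rewrite // !inE vu andbT; apply: contra nu => /eqP->.
case: (tree_subcubic v) => deg; have := card_other_neighbours vw; rewrite deg.
  move/eqP; rewrite cards_eq0 => /eqP N0.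
  suff /subset_leq_card : Q :&: branch v w \subset [set v] by rewrite cards1; lia.
  apply/subsetP=> x; rewrite in_setI in_set1 => /andP[_ xb]; apply: contraT => nxv.
  by have [u] := cover x xb nxv; rewrite N0 inE.
move/eqP/cards2P=> [u1 [u2 [_ N2]]].
have sub : Q :&: branch v w \subset (Q :&: branch u1 v) :|: (Q :&: branch u2 v).
  apply/subsetP=> x; rewrite in_setI => /andP[xQ xb].
  have [|u] := cover x xb.
    apply/eqP=> exv; have := subsetP Ql x xQ.
    by rewrite inE exv deg.
  by rewrite N2 in_set2 in_setU !in_setI xQ => /orP[]/eqP-> ->; rewrite ?orbT.
apply: leq_trans (subset_leq_card sub) _; apply: leq_trans (leq_card_setU _ _).1 _.
by rewrite -addnn leq_add // small // N2 !inE eqxx ?orbT.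
Qed.

End BalancedEdge.

(** * Existence of decompositions *)

Lemma ucycle_two_neighbours (V : eqType) (e : rel V) (c : seq V) v :
  symmetric e -> ucycle e c -> 2 < size c -> v \in c ->
  exists x y, [/\ e v x, e v y & x != y].
Proof.
move=> e_sym ec c3 /rot_to[i c' rc].
move: ec c3; rewrite -(rot_ucycle i) -(size_rot i) rc.
case: c' {rc} => [|x [|y p]] //= /andP[/= + /and3P[_ xp _]] _.
case/andP=> vx /andP[_]; rewrite rcons_path => /andP[_ lastv].
exists x, (last y p); split=> //; first by rewrite e_sym.
by apply: contraNneq xp => ->; apply: mem_last.
Qed.

(** Two new leaves are hung on the leaf l, which becomes a vertex of degree three.
A new vertex has degree one, so it lies on no cycle with at least three vertices. *)
Section SplitLeaf.

Variables (T : subcubic_tree) (l : T).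
Hypothesis l_leaf : l \in leaves T.

Definition split_adj (a b : T + bool) : bool :=
  match a, b with
  | inl x, inl y => adj x y
  | inl x, inr _ | inr _, inl x => x == l
  | inr _, inr _ => false
  end.

Lemma split_adj_sym : symmetric split_adj.
Proof. by move=> [x|b] [y|b'] //=; apply: adj_sym. Qed.

Lemma split_adj_irr : irreflexive split_adj.
Proof. by move=> [x|b] //=; apply: adj_irr. Qed.

Lemma split_nonempty : 0 < #|{: T + bool}|.
Proof. by rewrite card_sum card_bool addn2. Qed.

Lemma split_connected a b : connect split_adj a b.
Proof.
have to_l c : connect split_adj (inl l) c.
  case: c => [x|b']; last by apply: connect1; rewrite /= eqxx.
  have /connectP[p pp ->] := tree_connected l x.
  apply/connectP; exists (map inl p); last by rewrite last_map.
  by rewrite path_map.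
apply: connect_trans (to_l b).
by rewrite (sym_connect_sym split_adj_sym) to_l.
Qed.

Lemma split_acyclic c : ucycle split_adj c -> size c <= 2.
Proof.
move=> ec; rewrite leqNgt; apply/negP=> c3.
have no_new b : inr b \notin c.
  apply/negP=> bc.
  have [[x|?] [[y|?] [//= /eqP-> /eqP->]]] := ucycle_two_neighbours split_adj_sym ec c3 bc.
  by rewrite eqxx.
pose c' := pmap (fun a : T + bool => if a is inl x then Some x else None) c.
have ec' : c = map inl c'.
  rewrite /c'; elim: c no_new {ec c3 c'} => //= -[x|b] c IH nb.
    by rewrite /= -IH // => b; have := nb b; rewrite inE negb_or => /andP[].
  by have := nb b; rewrite inE eqxx.
have : ucycle (@adj T) c'.
  move: ec; rewrite ec' /ucycle (map_inj_uniq (@inl_inj _ _)) => /andP[+ ->].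
  by rewrite andbT; case: (c') => //= x p; rewrite -map_rcons path_map.
by move/tree_acyclic; rewrite leqNgt -(size_map (inl : T -> T + bool)) -ec' c3.
Qed.

Lemma degree_new b : degree split_adj (inr b) = 1.
Proof.
apply/eqP/cards1P; exists (inl l); apply/setP=> -[x|b']; rewrite !inE //=.
Qed.

Lemma degree_split : degree split_adj (inl l) = 3.
Proof.
have /eqP deg : degree (@adj T) l == 1 by move: l_leaf; rewrite inE.
have -> : degree split_adj (inl l) =
  #|[set (inl w : T + bool) | w in [set w | adj l w]] :|: [set inr true; inr false]|.
  rewrite /degree; congr #|pred_of_set _|; apply/setP=> -[x|b]; rewrite !inE /=.
    by rewrite !orbF mem_imset ?inE //; apply: inl_inj.
  by rewrite eqxx; case: b; rewrite !eqxx ?orbT.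
rewrite cardsU card_imset; last exact: inl_inj.
rewrite cards2 /= -[#|[set w | adj l w]|]/(degree _ l) deg.
rewrite disjoint_setI0 ?cards0 //.
apply/pred0P=> -[x|b] /=; rewrite !inE ?andbF //.
by apply/negbTE; rewrite negb_and; apply/orP; left; apply/imsetP=> -[].
Qed.

Lemma degree_old x : x != l -> degree split_adj (inl x) = degree (@adj T) x.
Proof.
move=> nxl; rewrite /degree -(card_imset _ (@inl_inj T bool)).
congr #|pred_of_set _|; apply/setP=> -[y|b]; rewrite !inE /=.
  by rewrite mem_imset ?inE //; apply: inl_inj.
by rewrite (negPf nxl); apply/esym/imsetP=> -[].
Qed.

Lemma split_subcubic a : degree split_adj a = 1 \/ degree split_adj a = 3.
Proof.
case: a => [x|b]; last by left; apply: degree_new.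
have [->|nxl] := eqVneq x l; first by right; apply: degree_split.
by rewrite degree_old //; apply: tree_subcubic.
Qed.

Definition split_leaf : subcubic_tree := SubcubicTree split_adj_sym split_adj_irr
  split_nonempty split_connected split_acyclic split_subcubic.

Lemma card_leaves_split : #|leaves split_leaf| = #|leaves T|.+1.
Proof.
have -> : leaves split_leaf =
  [set (inl w : T + bool) | w in leaves T :\ l] :|: [set inr true; inr false].
  apply/setP=> -[x|b]; rewrite !inE /=; last by rewrite degree_new; case: b; rewrite orbT.
  rewrite !orbF mem_imset ?inE; last exact: inl_inj.
  by have [->|nxl] := eqVneq x l; rewrite ?degree_split // degree_old.
rewrite cardsU card_imset; last exact: inl_inj.
rewrite cards2 /= (cardsD1 l (leaves T)) l_leaf disjoint_setI0 ?cards0; first by lia.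
apply/pred0P=> -[x|b] /=; rewrite !inE ?andbF //.
by apply/negbTE; rewrite negb_and; apply/orP; left; apply/imsetP=> -[].
Qed.

End SplitLeaf.

(** The tree with a single edge. *)
Definition edge_adj (a b : bool) := a != b.

Lemma edge_degree a : degree edge_adj a = 1.
Proof. by apply/eqP/cards1P; exists (~~ a); apply/setP=> b; rewrite !inE; case: a b => [] []. Qed.

Lemma edge_tree : exists T : subcubic_tree, #|leaves T| = 2.
Proof.
have esym : symmetric edge_adj by move=> a b; rewrite /edge_adj eq_sym.
have eirr : irreflexive edge_adj by move=> a; rewrite /edge_adj eqxx.
have econ a b : connect edge_adj a b.
  by have [->|nab] := eqVneq a b; [apply: connect0 | apply: connect1].
have eac c : ucycle edge_adj c -> size c <= 2.
  by case/andP=> _ uc; rewrite -(card_uniqP uc) -card_bool max_card.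
have esub a : degree edge_adj a = 1 \/ degree edge_adj a = 3 by left; apply: edge_degree.
have ene : 0 < #|{: bool}| by rewrite card_bool.
exists (SubcubicTree esym eirr ene econ eac esub).
rewrite -[RHS]card_bool -cardsT; congr #|pred_of_set _|; apply/setP=> a.
by rewrite !inE edge_degree.
Qed.

Lemma tree_with_leaves n : 1 < n -> exists T : subcubic_tree, #|leaves T| = n.
Proof.
elim: n => // -[//|[_ _|n IH _]]; first exact: edge_tree.
have [//|T cT] := IH.
have [l lT] : exists l, l \in leaves T by apply/set0Pn; rewrite -card_gt0 cT.
by exists (split_leaf lT); rewrite card_leaves_split cT.
Qed.

Lemma decomposition_exists (E : finType) : 1 < #|E| -> inhabited (decomposition E).
Proof.
move=> /tree_with_leaves[T cT].
pose f (x : E) : T := enum_val (cast_ord (esym cT) (enum_rank x)).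
have f_inj : injective f.
  by move=> x y /enum_val_inj/cast_ord_inj/enum_rank_inj.
have f_im : [set f x | x : E] = leaves T.
  apply/eqP; rewrite eqEcard card_imset // cT leqnn andbT.
  by apply/subsetP=> _ /imsetP[x _ ->]; apply: enum_valP.
by constructor; exact: Decomposition f_inj f_im.
Qed.

(** * The grid of lines *)

Lemma ordinal_injection (V : finType) (A : {set V}) s : s <= #|A| ->
  exists2 f : 'I_s -> V, injective f & forall t, f t \in A.
Proof.
move=> le; exists (fun t => enum_val (widen_ord le t)) => [t t' | t]; last exact: enum_valP.
by move/enum_val_inj/(congr1 val) => /= e; apply: val_inj.
Qed.

Section Grid.

Variable k : nat.

Definition grid : finType := ('I_k + 'I_k + ('I_k * 'I_k) * 'I_3)%type.

Definition point_a (i : 'I_k) : grid := inl (inl i).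
Definition point_b (j : 'I_k) : grid := inl (inr j).
Definition private_point (p : 'I_k * 'I_k) (c : 'I_3) : grid := inr (p, c).

Definition private_points (p : 'I_k * 'I_k) : {set grid} :=
  [set private_point p c | c : 'I_3].

Definition grid_line (p : 'I_k * 'I_k) : {set grid} :=
  [set point_a p.1; point_b p.2] :|: private_points p.

Lemma in_grid_line p x : (x \in grid_line p) =
  match x with
  | inl (inl i) => i == p.1
  | inl (inr j) => j == p.2
  | inr (q, _) => q == p
  end.
Proof.
rewrite !inE; case: x => [[i|j]|[q c]] /=.
- by rewrite orbF; case: imsetP => [[]|] //; rewrite orbF.
- by case: imsetP => [[]|] //; rewrite orbF.
- apply/imsetP/eqP => [[c' _ [-> _]] // | ->]; by exists c.
Qed.

Lemma card_private_points p : #|private_points p| = 3.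
Proof. by rewrite card_imset ?card_ord // => c c' []. Qed.

Lemma card_grid_line p : #|grid_line p| = 5.
Proof.
rewrite cardsU cards2 card_private_points disjoint_setI0 ?cards0 //.
apply/pred0P=> x /=; apply/negbTE/andP=> -[+ /imsetP[c _ ex]].
by rewrite ex !inE.
Qed.

Lemma grid_line_linear p q : p != q -> #|grid_line p :&: grid_line q| <= 1.
Proof.
move=> npq; apply/card_le1_eqP => x y /setIP[xp xq] /setIP[yp yq].
move: xp xq yp yq; rewrite !in_grid_line.
case: p q npq => [i j] [i' j'] /eqP npq /=.
by case: x y => [[a|b]|[r c]] [[a'|b']|[r' c']] /eqP xp /eqP xq /eqP yp /eqP yq;
  first [congruence | case: npq; congruence].
Qed.

Lemma private_points_sub p : private_points p \subset grid_line p.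
Proof. exact: subsetUr. Qed.

Lemma private_points_disjoint p q : p != q ->
  [disjoint private_points p & grid_line q].
Proof.
move=> npq; apply/pred0P=> x /=; apply/negbTE/andP=> -[/imsetP[c _ ->]].
by rewrite in_grid_line /= (negPf npq).
Qed.

Lemma grid_line_disjoint p q : p.1 != q.1 -> p.2 != q.2 ->
  [disjoint grid_line p & grid_line q].
Proof.
move=> n1 n2; apply/pred0P=> x /=; rewrite !in_grid_line.
have npq : p != q by apply: contraNneq n1 => ->.
by apply/negbTE/andP; case: x => [[i|j]|[r c]] [/eqP->];
  rewrite ?(negPf n1) ?(negPf n2) ?(negPf npq).
Qed.

Lemma card_grid : #|grid| = k + k + k * k * 3.
Proof. by rewrite !card_sum !card_prod !card_ord. Qed.

Hypothesis k_gt1 : 1 < k.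

Lemma grid_large : 5 < #|grid|.
Proof. by rewrite card_grid; nia. Qed.

Definition grid_matroid : matroid grid :=
  cosparse_matroid (isT : 2 < 5) card_grid_line grid_line_linear grid_large.

Lemma grid_matroid_transversal : transversal_matroid grid_matroid.
Proof.
apply: (cosparse_transversal _ _ _ _ private_points_sub private_points_disjoint).
  by move=> p; rewrite card_private_points.
by rewrite card_prod card_ord card_grid; nia.
Qed.

Lemma grid_branch_width : branch_width grid_matroid <= 6.
Proof.
rewrite /branch_width /min_nat; case: pselect => // exP.
case: ex_minnP => m /asboolP[D <-] _.
by apply/bigmax_leqP => e _; rewrite ltnS; apply: lambda_cosparse.
Qed.

(** One side of U contains at least s points b_j, and both sides contain s points
a_i; pairing b's of that side with a's of the other gives s disjoint lines crossing
U. The boolean b records whether the a's are taken in U. *)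
Lemma grid_sim_classes (U : {set grid}) s :
  s <= #|[set i | point_a i \in U]| -> s <= #|[set i | point_a i \notin U]| ->
  s.*2 <= k -> s <= sim_classes grid_matroid U.
Proof.
move=> leA leA' le2s.
have [b [f [h [[f_inj fb] [h_inj hb]]]]] : exists b : bool, exists f h : 'I_s -> 'I_k,
    (injective f /\ forall t, (point_a (f t) \in U) = b) /\
    (injective h /\ forall t, (point_b (h t) \in U) = ~~ b).
  pose B b := [set j | (point_b j \in U) == b].
  have [b leB] : exists b, s <= #|B (~~ b)|.
    have BC : B true = ~: B false by apply/setP=> j; rewrite !inE; case: (_ \in _).
    have := cardsC (B false); rewrite -BC card_ord => cB.
    have [le|lt] := leqP s #|B true|; first by exists false.
    have leF : s <= #|B false| by lia.
    by exists true.
  have [h h_inj hB] := ordinal_injection leB.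
  have leAb : s <= #|[set i | (point_a i \in U) == b]|.
    by case: (b) {leB hB}; [under eq_finset do rewrite eqb_id | under eq_finset do rewrite eqbF_neg].
  have [f f_inj fA] := ordinal_injection leAb.
  exists b, f, h; split; split=> // t.
    by have := fA t; rewrite inE => /eqP.
  by have := hB t; rewrite inE => /eqP.
apply: (sim_classes_cosparse _ _ _ _ (f := fun t => (f t, h t))) => [t t' ntt' | t | t].
- by apply: grid_line_disjoint; rewrite /= inj_eq.
- apply/set0Pn; case: b fb hb => fb hb; [exists (point_a (f t)) | exists (point_b (h t))];
    by rewrite in_setI in_grid_line ?fb ?hb /= eqxx.
- apply/set0Pn; case: b fb hb => fb hb; [exists (point_b (h t)) | exists (point_a (f t))];
    by rewrite in_setD in_grid_line ?fb ?hb /= eqxx.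
Qed.

End Grid.

(** With 3 s points a_i, a balanced edge leaves between s and 2 s - 2 of them on
one side, hence at least s on the other. *)
Lemma grid_decomposition_width s (k_gt1 : 1 < 3 * s) : 1 < s ->
  s <= decomposition_width (grid_matroid k_gt1).
Proof.
move=> s_gt1; rewrite /decomposition_width /min_nat; case: pselect => [exP | []]; last first.
  have [|D] := @decomposition_exists (grid (3 * s)).
    by apply: leq_trans (grid_large k_gt1).
  by exists (decomp_dw (grid_matroid k_gt1) D); apply/asboolP; exists D.
case: ex_minnP => m /asboolP[D <-] _ {exP}.
pose leaf_a i := dmap D (point_a i).
have leaf_a_inj : injective leaf_a by move=> i j /(@dmap_inj _ D) [].
pose Q := [set leaf_a i | i : 'I_(3 * s)].
have cQ : #|Q| = 3 * s by rewrite card_imset // card_ord.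
have Ql : Q \subset leaves (dtree D).
  apply/subsetP=> _ /imsetP[i _ ->]; rewrite -(dmap_leaves D); exact: imset_f.
have [|v [w [vw geU leU]]] := balanced_edge Ql s_gt1; first by rewrite cQ; lia.
pose A := [set i | point_a i \in displayed v w].
have cA : #|A| = #|Q :&: branch v w|.
  rewrite -(card_imset _ leaf_a_inj); congr #|pred_of_set _|.
  apply/setP=> x; rewrite in_setI; apply/imsetP/andP => [[i iA ->] | [/imsetP[i _ ->] xb]].
    by split; [apply: imset_f | move: iA; rewrite !inE].
  by exists i => //; move: xb; rewrite !inE.
have cA' : #|[set i | point_a i \notin displayed v w]| = 3 * s - #|A|.
  have -> : [set i | point_a i \notin displayed v w] = ~: A by apply/setP=> i; rewrite !inE.
  by have := cardsC A; rewrite card_ord; lia.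
apply: (@leq_trans (sim_classes (grid_matroid k_gt1) (displayed v w))).
  by apply: grid_sim_classes; rewrite ?cA' -/A ?cA; lia.
exact: (@leq_bigmax_cond _ (fun e : dtree D * dtree D => adj e.1 e.2)
  (fun e => sim_classes (grid_matroid k_gt1) (displayed e.1 e.2)) (v, w)).
Qed.

Theorem proposition6p1 : ~ pigeonhole transversal_matroid.
Proof.
move=> /(_ 6 isT)[rho small_dw].
have k_gt1 : 1 < 3 * rho.+2 by lia.
have := small_dw _ _ (grid_matroid_transversal k_gt1) (grid_branch_width k_gt1).
by have := @grid_decomposition_width rho.+2 k_gt1 isT; lia.
Qed.
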